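(* Let $\mathcal{A}_i$ be an optimal active set of the multiparametric quadratic program (mpQP), with complement $\mathcal{N}_i$, and let the parametric solution for $\mathcal{A}_i$ be $\lambda^*(\theta)=\tilde q_i+\tilde Q_i\theta$, $z^*(\theta)=k_i+K_i\theta$. Let $l\in\mathcal{N}_i$ be such that $\mathcal{A}_j=\mathcal{A}_i\cup\{l\}$ is also an optimal active set, with complement $\mathcal{N}_j$. Assume $G_{\mathcal{A}_i}$ and $G_{\mathcal{A}_j}$ have full row rank. Then there exist $c_j\in\mathbb{R}$, $v_j\in\mathbb{R}^{n}$, $f_j\in\mathbb{R}^{m}$ and $\tilde d_j\in\mathbb{R}^{p}$ with $\tilde d_{j,\mathcal{N}_j}=0$ and $\tilde d_{j,l}=-1$ (the entries $\tilde d_{j,\mathcal{A}_i}$ being possibly non-zero), such that the parametric solution for $\mathcal{A}_j$ is given, for all $\theta\in\mathbb{R}^n$, by $$\lambda^*(\theta)=\tilde q_j+\tilde Q_j\theta=\tilde q_i+\tilde Q_i\theta-\tilde d_j\,(c_j+v_j^T\theta),$$ $$z^*(\theta)=k_j+K_j\theta=k_i+K_i\theta+f_j\,(c_j+v_j^T\theta).$$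
   Context: Problem (mpQP): for a parameter $\theta\in\Theta\subseteq\mathbb{R}^n$ ($\Theta$ a polyhedral set), minimize $\frac12 z^T H z$ over $z\in\mathbb{R}^m$ subject to $Gz\preceq b+S\theta$, where $H\in\mathbb{R}^{m\times m}$ is symmetric positive definite, $G\in\mathbb{R}^{p\times m}$, $b\in\mathbb{R}^p$, $S\in\mathbb{R}^{p\times n}$, and $\preceq$ is componentwise. Lagrange multipliers of the inequalities are denoted $\lambda\in\mathbb{R}^p$ (KKT conditions: $Hz+G^T\lambda=0$, $Gz\preceq b+S\theta$, $\lambda\succeq0$, complementary slackness). Indexing: for an index set $\mathcal{I}\subseteq\{1,\dots,p\}$, $G_{\mathcal{I}}$, $b_{\mathcal{I}}$, $S_{\mathcal{I}}$ denote the rows indexed by $\mathcal{I}$; for indexed quantities such as $\tilde q_i,\tilde Q_i,\tilde d_j$, a second index denotes the corresponding entries or rows, e.g. $\tilde q_{i,\mathcal{I}}$. Optimal active set: a set $\mathcal{A}\subseteq\{1,\dots,p\}$ that, for some $\theta\in\Theta$ for which the problem is feasible, is exactly the set of constraints holding with equality at the optimum, with no weakly active constraints (the multipliers indexed by $\mathcal{A}$ are nonzero). Its complement is $\mathcal{N}=\{1,\dots,p\}\setminus\mathcal{A}$. Optimal active sets are denoted $\mathcal{A}_i$, with complements $\mathcal{N}_i$. Standing assumption (LICQ): $G_{\mathcal{A}_i}$ has full row rank. Parametric solution for $\mathcal{A}_i$: the affine functions $\lambda^*(\theta)=\tilde q_i+\tilde Q_i\theta$ and $z^*(\theta)=k_i+K_i\theta$,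 where $\tilde q_i\in\mathbb{R}^p$, $\tilde Q_i\in\mathbb{R}^{p\times n}$ satisfy $\tilde q_{i,\mathcal{N}_i}=0$, $\tilde Q_{i,\mathcal{N}_i}=0$, $$\tilde q_{i,\mathcal{A}_i}=-(G_{\mathcal{A}_i}H^{-1}G_{\mathcal{A}_i}^T)^{-1}b_{\mathcal{A}_i},\qquad \tilde Q_{i,\mathcal{A}_i}=-(G_{\mathcal{A}_i}H^{-1}G_{\mathcal{A}_i}^T)^{-1}S_{\mathcal{A}_i},$$ and $k_i=-H^{-1}G_{\mathcal{A}_i}^T\tilde q_{i,\mathcal{A}_i}\in\mathbb{R}^m$, $K_i=-H^{-1}G_{\mathcal{A}_i}^T\tilde Q_{i,\mathcal{A}_i}\in\mathbb{R}^{m\times n}$. (This is the primal-dual solution of minimizing $\frac12z^THz$ subject to $G_{\mathcal{A}_i}z=b_{\mathcal{A}_i}+S_{\mathcal{A}_i}\theta$, and it solves the mpQP for $\theta$ in the critical region of $\mathcal{A}_i$.) When $\mathcal{A}_i=\emptyset$, all these quantities are zero. *)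

(* Defs.v *)
From HB Require Import structures.
From mathcomp Require Import all_boot all_order all_algebra.
From mathcomp Require Import reals.

Set Implicit Arguments.
Unset Strict Implicit.
Unset Printing Implicit Defensive.

Import Order.TTheory GRing.Theory Num.Theory.
Local Open Scope ring_scope.

Definition vle (R : realType) (k : nat) (x y : 'cV[R]_k) : Prop :=
  forall i, x i 0 <= y i 0.

Definition posdefmx (R : realType) (m : nat) (H : 'M[R]_m) : Prop :=
  H^T = H /\ forall z : 'cV[R]_m, z != 0 -> 0 < (z^T *m H *m z) 0 0.

Definition polyhedral (R : realType) (n : nat) (X : 'cV[R]_n -> Prop) : Prop :=
  exists (r : nat) (E : 'M[R]_(r, n)) (e : 'cV[R]_r),
    forall x, X x <-> vle (E *m x) e.

(* Data of: minimize (1/2) z^T H z over z in R^m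
   subject to G z <= b + S theta, with theta in Theta, a subset of R^n. *)
Record mpQP (R : realType) (n m p : nat) := MpQP {
  qpH : 'M[R]_m;
  qpG : 'M[R]_(p, m);
  qpb : 'cV[R]_p;
  qpS : 'M[R]_(p, n);
  qpTheta : 'cV[R]_n -> Prop;
  qpH_posdef : posdefmx qpH;
  qpTheta_polyhedral : polyhedral qpTheta }.

(* M_I: the rows of M with index in I, in increasing order. *)
Definition rows (R : realType) (p k : nat) (I : {set 'I_p})
    (M : 'M[R]_(p, k)) : 'M[R]_(#|I|, k) :=
  rowsub (fun s : 'I_#|I| => enum_val s) M.

(* Left multiplication by the transposed selection matrix of I; the result is
   the matrix whose rows in I are those of X and whose other rows vanish, see
   rows_zero_pad and zero_pad_notin. *)
Definition zero_pad (R : realType) (p k : nat) (I : {set 'I_p})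
    (X : 'M[R]_(#|I|, k)) : 'M[R]_(p, k) :=
  (rows I 1%:M)^T *m X.

Lemma rows_zero_pad (R : realType) (p k : nat) (I : {set 'I_p})
  (X : 'M[R]_(#|I|, k)) : rows I (zero_pad X) = X.
Proof.
apply/matrixP => s j; rewrite !mxE (bigD1 s) //= !mxE eqxx mul1r.
rewrite big1 ?addr0 // => t ts.
by rewrite !mxE (inj_eq enum_val_inj) (negbTE ts) mul0r.
Qed.

Lemma zero_pad_notin (R : realType) (p k : nat) (I : {set 'I_p})
  (X : 'M[R]_(#|I|, k)) (i : 'I_p) (j : 'I_k) :
  i \notin I -> zero_pad X i j = 0.
Proof.
move=> iI; rewrite !mxE big1 // => t _; rewrite !mxE.
case: eqP => [ti|_]; last by rewrite mul0r.
by move: iI; rewrite -ti enum_valP.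
Qed.

Section MpQPTheory.
Variables (R : realType) (n m p : nat) (P : mpQP R n m p).

Local Notation H := (qpH P).
Local Notation G := (qpG P).
Local Notation b := (qpb P).
Local Notation S := (qpS P).

Definition qp_cost (z : 'cV[R]_m) : R := 2^-1 * (z^T *m H *m z) 0 0.

Definition qp_feasible (theta : 'cV[R]_n) (z : 'cV[R]_m) : Prop :=
  vle (G *m z) (b + S *m theta).

Definition qp_optimal (theta : 'cV[R]_n) (z : 'cV[R]_m) : Prop :=
  qp_feasible theta z /\
  forall z', qp_feasible theta z' -> qp_cost z <= qp_cost z'.

Definition KKT (theta : 'cV[R]_n) (z : 'cV[R]_m) (lambda : 'cV[R]_p) : Prop :=
  [/\ H *m z + G^T *m lambda = 0,
      vle (G *m z) (b + S *m theta),
      vle 0 lambda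
    & forall i, lambda i 0 * (G *m z - b - S *m theta) i 0 = 0].

Definition active_set (theta : 'cV[R]_n) (z : 'cV[R]_m) : {set 'I_p} :=
  [set i | (G *m z) i 0 == (b + S *m theta) i 0].

(* The last clause says that no constraint in A is weakly active. *)
Definition optimal_active_set (A : {set 'I_p}) : Prop :=
  exists (theta : 'cV[R]_n) (z : 'cV[R]_m) (lambda : 'cV[R]_p),
    [/\ qpTheta P theta, qp_optimal theta z, KKT theta z lambda,
        A = active_set theta z
      & forall i, i \in A -> lambda i 0 != 0].

(* The coefficients of the parametric solution for A,
   lambda(theta) = qtilde A + Qtilde A *m theta and
   z(theta) = kvec A + Kmx A *m theta. *)
Definition schur_mx (A : {set 'I_p}) : 'M[R]_#|A| :=
  rows A G *m invmx H *m (rows A G)^T.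

Definition qtilde (A : {set 'I_p}) : 'cV[R]_p :=
  zero_pad (- (invmx (schur_mx A) *m rows A b)).

Definition Qtilde (A : {set 'I_p}) : 'M[R]_(p, n) :=
  zero_pad (- (invmx (schur_mx A) *m rows A S)).

Definition kvec (A : {set 'I_p}) : 'cV[R]_m :=
  - (invmx H *m (rows A G)^T *m rows A (qtilde A)).

Definition Kmx (A : {set 'I_p}) : 'M[R]_(m, n) :=
  - (invmx H *m (rows A G)^T *m rows A (Qtilde A)).

End MpQPTheory.

(* Main.v *)
Require Import Defs.
From mathcomp Require Import all_boot all_order all_algebra.
From mathcomp Require Import reals.
Import Order.TTheory GRing.Theory Num.Theory.
Local Open Scope ring_scope.

Set Implicit Arguments.
Unset Strict Implicit.
Unset Printing Implicit Defensive.

(** Put [M = G H^-1 G^T]. The multiplier of an active set [A] at [theta] is the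
    unique vector [x] supported on [A] with [(M x)_A = - (b + S theta)_A],
    because the principal submatrix of [M] on [A] is positive definite. Let [w]
    be supported on [A] with [(M w)_A = (M e_l)_A], and put [d = w - e_l], so
    that [(M d)_A = 0] and [d_l = -1]. If [y] is the multiplier of [l |: A],
    then [y + y_l d] vanishes at [l] and still satisfies the equations indexed
    by [A], hence is the multiplier of [A]. The minimizer is the image of the
    multiplier under [- H^-1 G^T]. *)

Section RestrictedSystem.
Variables (K : comUnitRingType) (p : nat) (M : 'M[K]_p).
Implicit Types (A : {set 'I_p}) (l : 'I_p).

Definition supported_on k A (X : 'M[K]_(p, k)) : Prop :=
  forall i, i \notin A -> row i X = 0.

Definition solves_on k A (B X : 'M[K]_(p, k)) : Prop :=
  supported_on A X /\ {in A, forall i, row i (M *m X) = row i B}.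

Definition principal_submx A : 'M[K]_#|A| := mxsub enum_val enum_val M.

Definition exchange_direction l (w : 'cV[K]_p) : 'cV[K]_p := w - delta_mx l 0.

Lemma supported_onP k A (X : 'M[K]_(p, k)) :
  supported_on A X <-> forall i j, i \notin A -> X i j = 0.
Proof.
split=> X0 i; last by move=> iA; apply/rowP => j; rewrite [LHS]mxE [RHS]mxE X0.
by move=> j /X0/rowP/(_ j); rewrite [LHS]mxE [RHS]mxE.
Qed.

Lemma rowsub_enum_valP k A (X Y : 'M[K]_(p, k)) :
  rowsub (@enum_val _ (mem A)) X = rowsub enum_val Y
  <-> {in A, forall i, row i X = row i Y}.
Proof.
split=> [/row_matrixP eqXY i iA | eqXY].
  by have := eqXY (enum_rank_in iA i); rewrite !row_rowsub enum_rankK_in.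
by apply/row_matrixP => s; rewrite !row_rowsub eqXY ?enum_valP.
Qed.

Lemma rowsub_mulmx_supported k A (X : 'M[K]_(p, k)) :
  supported_on A X ->
  rowsub enum_val (M *m X) = principal_submx A *m rowsub enum_val X.
Proof.
move=> /supported_onP Xsupp; apply/matrixP => s j.
rewrite !mxE (bigID [in A]) /=.
rewrite [X in _ + X]big1 ?addr0 => [|i iA]; last by rewrite Xsupp ?mulr0.
by rewrite big_enum_val; apply: eq_bigr => t _; rewrite !mxE.
Qed.

Lemma solves_on_unique k A (B X Y : 'M[K]_(p, k)) :
  principal_submx A \in unitmx -> solves_on A B X -> solves_on A B Y -> X = Y.
Proof.
move=> Munit [Xsupp XB] [Ysupp YB].
have eqA : {in A, forall i, row i X = row i Y}.
  apply/rowsub_enum_valP/(can_inj (mulKmx Munit)).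
  rewrite -!rowsub_mulmx_supported //.
  by apply/rowsub_enum_valP => i iA; rewrite XB ?YB.
apply/row_matrixP => i; have [/eqA // | iA] := boolP (i \in A).
by rewrite Xsupp ?Ysupp.
Qed.

Section ExchangeDirection.
Variables (A : {set 'I_p}) (l : 'I_p) (w : 'cV[K]_p).
Hypotheses (lA : l \notin A) (w_solves : solves_on A (col l M) w).

Lemma exchange_direction_supported :
  supported_on (l |: A) (exchange_direction l w).
Proof.
apply/supported_onP => i j; rewrite !inE negb_or => /andP[il iA].
rewrite !mxE (negbTE il) subr0.
by have /supported_onP -> := w_solves.1.
Qed.

Lemma exchange_direction_pivot : exchange_direction l w l 0 = -1.
Proof.
rewrite !mxE !eqxx; have /supported_onP -> // := w_solves.1.
by rewrite sub0r.
Qed.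

Lemma exchange_direction_ker :
  {in A, forall i, row i (M *m exchange_direction l w) = 0}.
Proof.
by move=> i iA; rewrite mulmxBr -colE linearB /= w_solves.2 ?subrr.
Qed.

Lemma solves_on_setU1 k (B X Y : 'M[K]_(p, k)) :
  principal_submx A \in unitmx -> solves_on A B X -> solves_on (l |: A) B Y ->
  Y = X - exchange_direction l w *m row l Y.
Proof.
move=> Munit Xsolves [Ysupp YB]; set d := exchange_direction l w.
suff YdE : solves_on A B (Y + d *m row l Y).
  by rewrite (solves_on_unique Munit Xsolves YdE) addrK.
split=> i iA.
  rewrite linearD /= row_mul; have [->|il] := eqVneq i l.
    rewrite [row l d]mx11_scalar mul_scalar_mx mxE.
    by rewrite exchange_direction_pivot scaleN1r subrr.
  have ilA : i \notin l |: A by rewrite !inE negb_or il.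
  by rewrite Ysupp ?exchange_direction_supported // mul0mx addr0.
rewrite mulmxDr mulmxA linearD /= (row_mul _ (M *m d)).
by rewrite exchange_direction_ker // mul0mx addr0 YB // setU1r.
Qed.

End ExchangeDirection.
End RestrictedSystem.

Lemma tr_rows_mulmx (R : realType) (p m k : nat) (A : {set 'I_p})
    (F : 'M[R]_(p, m)) (X : 'M[R]_(#|A|, k)) :
  (rows A F)^T *m X = F^T *m zero_pad X.
Proof. by rewrite /rows rowsubE trmx_mul mulmxA. Qed.

Lemma zero_pad_solves_on (R : realType) (p k : nat) (M : 'M[R]_p)
    (A : {set 'I_p}) (B : 'M[R]_(p, k)) :
  principal_submx M A \in unitmx ->
  solves_on M A B (zero_pad (invmx (principal_submx M A) *m rows A B)).
Proof.
move=> Munit; set Y := zero_pad _.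
have Ysupp : supported_on A Y.
  by apply/supported_onP => i j; apply: zero_pad_notin.
split=> //; apply/rowsub_enum_valP.
by rewrite rowsub_mulmx_supported // [rowsub _ _]rows_zero_pad mulKVmx.
Qed.

Section PositiveDefinite.
Variable R : realType.

Lemma posdefmx_unit (m : nat) (H : 'M[R]_m) : posdefmx H -> H \in unitmx.
Proof.
move=> [_ Hpos]; rewrite -row_free_unit; apply: inj_row_free => v vH0.
apply/eqP/contraT; rewrite -trmx_eq0 => /Hpos.
by rewrite trmxK vH0 mul0mx mxE ltxx.
Qed.

Lemma posdefmx_congr (m k : nat) (H : 'M[R]_m) (F : 'M[R]_(k, m)) :
  posdefmx H -> row_free F -> posdefmx (F *m H *m F^T).
Proof.
move=> [Hsym Hpos] Ffree; split=> [|z z0].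
  by rewrite !trmx_mul trmxK Hsym mulmxA.
have /Hpos : F^T *m z != 0.
  by rewrite -trmx_eq0 trmx_mul trmxK mulmx_free_eq0 // trmx_eq0.
by rewrite trmx_mul trmxK !mulmxA.
Qed.

Lemma posdefmx_inv (m : nat) (H : 'M[R]_m) : posdefmx H -> posdefmx (invmx H).
Proof.
move=> Hpd; have Hunit := posdefmx_unit Hpd.
have -> : invmx H = invmx H *m H *m (invmx H)^T.
  by rewrite mulVmx // mul1mx trmx_inv Hpd.1.
by apply: posdefmx_congr => //; rewrite row_free_unit unitmx_inv.
Qed.

End PositiveDefinite.

Section ParametricSolution.
Variables (R : realType) (n m p : nat) (P : mpQP R n m p).
Implicit Types (A : {set 'I_p}) (theta : 'cV[R]_n).

Local Notation G := (qpG P).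
Local Notation H := (qpH P).

Definition dual_hessian : 'M[R]_p := G *m invmx H *m G^T.

Definition multiplier A theta : 'cV[R]_p :=
  qtilde P A + Qtilde P A *m theta.

Definition minimizer A theta : 'cV[R]_m :=
  kvec P A + Kmx P A *m theta.

Lemma schur_mxE A : schur_mx P A = principal_submx dual_hessian A.
Proof.
by rewrite /schur_mx /rows trmx_mxsub mul_rowsub_mx -mxsub_mul.
Qed.

Lemma schur_mx_unit A : row_free (rows A G) -> schur_mx P A \in unitmx.
Proof.
move=> Gfree; apply/posdefmx_unit/posdefmx_congr => //.
exact/posdefmx_inv/qpH_posdef.
Qed.

Lemma multiplierE A theta :
  multiplier A theta =
  zero_pad (invmx (schur_mx P A) *m rows A (- (qpb P + qpS P *m theta))).
Proof.
have rows_rhs : rows A (- (qpb P + qpS P *m theta)) =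
    - (rows A (qpb P) + rows A (qpS P) *m theta).
  by rewrite mul_rowsub_mx -linearD -linearN.
rewrite /multiplier /qtilde /Qtilde rows_rhs /zero_pad !mulmxN !mulNmx.
by rewrite -opprD -!mulmxA -!mulmxDr.
Qed.

Lemma multiplier_solves_on A theta :
  row_free (rows A G) ->
  solves_on dual_hessian A (- (qpb P + qpS P *m theta)) (multiplier A theta).
Proof.
move=> /schur_mx_unit; rewrite multiplierE schur_mxE.
exact: zero_pad_solves_on.
Qed.

Lemma minimizerE A theta :
  minimizer A theta = - (invmx H *m G^T *m multiplier A theta).
Proof.
rewrite /minimizer /kvec /Kmx /multiplier !rows_zero_pad -!mulmxA.
by rewrite !(tr_rows_mulmx G) mulNmx -opprD -!mulmxA -!mulmxDr.
Qed.

Lemma multiplier_coord A theta i :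
  multiplier A theta i 0 =
  qtilde P A i 0 + (row i (Qtilde P A) *m theta) 0 0.
Proof. by rewrite -row_mul 2!mxE [in RHS]mxE. Qed.

Lemma multiplier_setU1 A l theta (w : 'cV[R]_p) :
  l \notin A -> row_free (rows A G) -> row_free (rows (l |: A) G) ->
  solves_on dual_hessian A (col l dual_hessian) w ->
  multiplier (l |: A) theta =
  multiplier A theta - multiplier (l |: A) theta l 0 *: exchange_direction l w.
Proof.
move=> lA Afree lAfree w_solves.
rewrite {1}(solves_on_setU1 lA w_solves _ (multiplier_solves_on theta Afree)
  (multiplier_solves_on theta lAfree)) -?schur_mxE ?schur_mx_unit //.
by rewrite [row l _]mx11_scalar mul_mx_scalar [row l _ _ _]mxE.
Qed.

Lemma minimizer_shift A A' theta (a : R) (d : 'cV[R]_p) :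
  multiplier A' theta = multiplier A theta - a *: d ->
  minimizer A' theta = minimizer A theta + a *: (invmx H *m G^T *m d).
Proof.
by move=> mulE; rewrite !minimizerE mulE mulmxBr -scalemxAr opprB addrC.
Qed.

End ParametricSolution.

Theorem theorem1 (R : realType) (n m p : nat) (P : mpQP R n m p)
    (Ai Aj : {set 'I_p}) (l : 'I_p)
    (hAi : optimal_active_set P Ai)
    (hl : l \in ~: Ai)
    (hAij : Aj = Ai :|: [set l])
    (hAj : optimal_active_set P Aj)
    (hGi : row_free (rows Ai (qpG P)))
    (hGj : row_free (rows Aj (qpG P))) :
  exists (c : R) (v : 'cV[R]_n) (f : 'cV[R]_m) (d : 'cV[R]_p),
    [/\ forall i, i \in ~: Aj -> d i 0 = 0,
        d l 0 = -1,
        forall theta : 'cV[R]_n,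
          qtilde P Aj + Qtilde P Aj *m theta =
          qtilde P Ai + Qtilde P Ai *m theta - (c + (v^T *m theta) 0 0) *: d
      & forall theta : 'cV[R]_n,
          kvec P Aj + Kmx P Aj *m theta =
          kvec P Ai + Kmx P Ai *m theta + (c + (v^T *m theta) 0 0) *: f].
Proof.
have lAi : l \notin Ai by rewrite inE in hl.
subst Aj; rewrite setUC in hGj *.
have [w w_solves] : exists w, solves_on (dual_hessian P) Ai
    (col l (dual_hessian P)) w.
  eexists; apply: zero_pad_solves_on.
  by rewrite -schur_mxE schur_mx_unit.
have multE theta := multiplier_setU1 theta lAi hGi hGj w_solves.
pose d := exchange_direction l w.
exists (qtilde P (l |: Ai) l 0), (row l (Qtilde P (l |: Ai)))^T.
exists (invmx (qpH P) *m (qpG P)^T *m d), d; split=> [i||theta|theta].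
- have /supported_onP d_off := exchange_direction_supported w_solves.
  by rewrite inE => /d_off.
- exact: exchange_direction_pivot lAi w_solves.
- by rewrite trmxK -multiplier_coord; apply: multE.
- by rewrite trmxK -multiplier_coord; apply/minimizer_shift/multE.
Qed.
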